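(* Let $\omega$ be a primitive sixth root of unity. Then for all nonnegative integers $a$ and $m$, $$\begin{aligned}\det_{0\le i,j\le a-1}\left(\omega\,\delta_{ij}+\binom{m+i+j}{j}\right)={}&\frac{(1+\omega)^a\left(\frac23\right)^{\lfloor a/2\rfloor}}{\prod_{i=1}^{\lfloor a/2\rfloor}(2i-1)!!\,\prod_{i=1}^{\lfloor(a-1)/2\rfloor}(2i-1)!!}\\&\times\prod_{i\ge0}\left(\tfrac m2+3i+\tfrac32\right)_{\lfloor(a-4i-1)/2\rfloor}\left(\tfrac m2+3i+\tfrac52\right)_{\lfloor(a-4i-2)/2\rfloor}\\&\qquad\cdot\left(\tfrac m2+a-i\right)_{\lfloor(a-4i)/2\rfloor}\left(\tfrac m2+a-i\right)_{\lfloor(a-4i-3)/2\rfloor}.\end{aligned}$$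
   Context: $\delta_{ij}$ is the Kronecker delta; $(\alpha)_k=\alpha(\alpha+1)\cdots(\alpha+k-1)$ for $k\ge1$, $(\alpha)_0=1$; $(2i-1)!!=1\cdot3\cdots(2i-1)$; empty products and the empty determinant are 1. In the subscripts on the right-hand side, $\lfloor\alpha\rfloor$ is the usual floor if $\alpha\ge0$ but is read as $0$ if $\alpha<0$, so that the product over $i\ge0$ is finite. *)

(* Defs.v *)
From mathcomp Require Import all_boot all_order all_algebra.
Set Implicit Arguments.
Unset Strict Implicit.
Unset Printing Implicit Defensive.
Import GRing.Theory.
Local Open Scope ring_scope.

(* The rising factorial (x)_k; the library only has the falling one, on nat. *)
Definition poch (R : pzRingType) (x : R) (k : nat) : R :=
  \prod_(l < k) (x + l%:R).

(* odd_dfact i is (2i-1)!!, indexed by i so that i = 0 gives 1. *)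
Definition odd_dfact (i : nat) : nat := (\prod_(1 <= l < i.+1) (2 * l - 1))%N.

(* floor_half a k is the floor of (a-k)/2, read as 0 when a < k: the
   subtraction is the truncated one on nat. *)
Definition floor_half (a k : nat) : nat := ((a - k)./2)%N.

(* Main.v *)
From HB Require Import structures.
Require Import Defs.
From mathcomp Require Import all_boot all_order all_algebra.
From mathcomp Require Import classical_sets fsbigop.
From mathcomp Require Import ring zify.
Set Implicit Arguments.
Unset Strict Implicit.
Unset Printing Implicit Defensive.
Import GRing.Theory Num.Theory.
Local Open Scope ring_scope.

(** Why the evaluation holds.

    The matrix is a Gram matrix in disguise.  For a complex number z let L_z
    be the functional
      p |-> (1 - z)^(m+1) * sum_k z^k (m+1)_k / k! * p (k + (m+1)/2)
    (Abel summation), for which the Meixner polynomials of parameter z are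
    orthogonal, and let ell_m be the combination of L_z for the two primitive
    cube roots of unity, with weight omega at z = - omega and weight 1 at
    z = - 1/omega, divided by 1 + omega.  Expanding the generating function
    (1 - omega x)^k (1 - x/omega)^(-k-m-1) gives polynomials q_0, q_1, ... with
    deg q_i = i for which  m! (1 + omega) ell_m (q_i q_j)  is (m+i)! j! times
    the entry (i, j) of the matrix (ell_meixner_mul).  Hence the determinant
    is, up to explicit factors, the Hankel determinant of the moments of ell_m,
    that is, the product of the norms of the monic orthogonal polynomials P_n
    of ell_m.

    The decisive fact is that the three-term recurrence of P_n has
    coefficients that are rational functions of m and n, on each parity class
    of n.  It is proved by letting m vary: multiplication by
    X^2 - ((m+1)/2)^2 turns ell_m into a multiple of ell_(m+2).  This shift
    and the two values ell_m 1 and ell_m X, for all m, determine every moment,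
    so the functional is defined by them here, and the sums over k never
    appear.  On the side of polynomials the shift is a Christoffel
    transformation: (X^2 - ((m+1)/2)^2) P_n^(m+2) is an explicit combination of
    P_(n+2)^(m), P_(n+1)^(m), P_n^(m), because the recurrence coefficients
    satisfy four rational-function identities (christoffel_three_term).  An
    induction on n, for all m at once, then gives ell_m P_n = 0 for n > 0, and
    orthogonality follows.  The evaluation of ell_m (q_i) is the same argument
    for the recurrence of the q_i.

    The outcome is a double product (det_double_product): consecutive
    determinants have ratio 1 + omega times kappa_1 ... kappa_a with kappa_l
    rational.  The right-hand side of the theorem has the same ratios: its
    product over i >= 0 reproduces itself under (a, m) -> (a - 4, m + 6) after
    its first factor is removed, and kappa_1 ... kappa_a changes under the same
    substitution by a rational factor (rho_shift), so that an induction in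
    steps of four applies (rhs_prod_step). *)

(** * Recurrence coefficients and their identities *)

Definition alpha_even (F : numFieldType) (y x : F) : F :=
  ((y + 1) * (y + 2) / 6 + x ^+ 2 / (y + 2 * x)) / (y + 2 * x + 2).
Definition alpha_odd (F : numFieldType) (y x : F) : F :=
  (2 + 4 * y + y ^+ 2 - y ^+ 3 + x * (8 + 6 * y - 2 * y ^+ 2) + 6 * x ^+ 2)
  / (6 * (y + 2 * x) * (y + 2 * x + 2)).
Definition beta_even (F : numFieldType) (y x : F) : F :=
  - (x * (y + x) * (2 * y + 3 * x) * (y + 3 * x)) / (4 * (y + 2 * x) ^+ 2).
Definition beta_odd (F : numFieldType) (y x : F) : F :=
  - (((2 * y + 3 * x) ^+ 2 - 1) * ((y + 3 * x) ^+ 2 - 1))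
  / (36 * (y + 2 * x) ^+ 2).
Definition gamma_even (F : numFieldType) (y x : F) : F :=
  (y + x + 2) ^+ 2 / ((y + 2 * x + 2) * (y + 2 * x + 4)).
Definition gamma_odd (F : numFieldType) (y x : F) : F :=
  (x + 1) * (3 * x + 2 * y + 5) / (3 * (y + 2 * x + 2) * (y + 2 * x + 4)).
Definition eps_even (F : numFieldType) (y x : F) : F :=
  - ((y + x + 2) * (2 * y + 3 * x + 2) * (2 * y + 3 * x + 4) * (y + 3 * x + 2))
  / (12 * (y + 2 * x + 2) ^+ 2).
Definition eps_odd (F : numFieldType) (y x : F) : F :=
  - ((y + x + 1) * (2 * y + 3 * x + 5) * (2 * y + 3 * x + 3) * (y + 3 * x + 3))
  / (12 * (y + 2 * x + 2) ^+ 2).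

Definition by_parity (F : numFieldType) (even_case odd_case : F -> F -> F)
    (m n : nat) : F :=
  if odd n then odd_case m%:R n%:R else even_case m%:R n%:R.

(** The monic orthogonal polynomials of ell_m satisfy
    P_(n+1) = (X - alpha_n) P_n - beta_n P_(n-1).  At m = n = 0 the summand
    x ^+ 2 / (y + 2 * x) of alpha_even is 0 / 0, whose value 0 is the correct
    one. *)
Definition alpha (F : numFieldType) : nat -> nat -> F :=
  by_parity (@alpha_even F) (@alpha_odd F).
Definition beta (F : numFieldType) : nat -> nat -> F :=
  by_parity (@beta_even F) (@beta_odd F).

(** The coefficients of P_(n+1) and P_n in the expansion of
    (X^2 - ((m+1)/2)^2) times the n-th orthogonal polynomial for m + 2. *)
Definition gamma (F : numFieldType) : nat -> nat -> F :=
  by_parity (@gamma_even F) (@gamma_odd F).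
Definition eps (F : numFieldType) : nat -> nat -> F :=
  by_parity (@eps_even F) (@eps_odd F).

(** Every denominator below is a sum of natural numbers with a positive
    numeral among its terms. *)
Ltac nonzero :=
  repeat (apply/andP; split);
  do 3 rewrite -?natrM -?natrD ?nat1r ?natr1;
  rewrite pnatr_eq0; lia.

Ltac parity_field :=
  rewrite /alpha /beta /gamma /eps /by_parity /=;
  match goal with |- context [odd ?k] => case: (odd k) end => /=;
  rewrite /alpha_even /alpha_odd /beta_even /beta_odd /gamma_even /gamma_odd
    /eps_even /eps_odd;
  field; nonzero.

Lemma alpha0 (F : numFieldType) m : alpha F m 0 = m.+1%:R / 6.
Proof.
rewrite /alpha /by_parity /= /alpha_even expr0n mul0r.
by field; nonzero.
Qed.

Lemma beta0 (F : numFieldType) m : beta F m 0 = 0.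
Proof. by rewrite /beta /by_parity /= /beta_even; ring. Qed.

Lemma gamma0 (F : numFieldType) m : gamma F m 0 = alpha F m 0 + alpha F m 1.
Proof.
rewrite alpha0 /gamma /alpha /by_parity /= /gamma_even /alpha_odd.
by field; nonzero.
Qed.

Lemma eps0 (F : numFieldType) m : eps F m 0 = - (m.+1%:R * m.+2%:R) / 3.
Proof. by rewrite /eps /by_parity /= /eps_even; field; nonzero. Qed.

Lemma beta1 (F : numFieldType) m :
  beta F m 1 = m.+1%:R ^+ 2 / 4 + eps F m 0 - alpha F m 0 * alpha F m 0.
Proof.
rewrite eps0 alpha0 /beta /by_parity /= /beta_odd.
by field; nonzero.
Qed.

(** The next four lemmas are the comparison of coefficients at P_(n+2),
    P_(n+1), P_n and P_(n-1) that christoffel_three_term asks for. *)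
Lemma gammaS (F : numFieldType) m n :
  gamma F m n.+1 = alpha F m n.+2 + gamma F m n - alpha F m.+2 n.
Proof. parity_field. Qed.

Lemma epsS (F : numFieldType) m n :
  eps F m n.+1 = beta F m n.+2 + gamma F m n * alpha F m n.+1 + eps F m n
    - alpha F m.+2 n * gamma F m n - beta F m.+2 n.
Proof. parity_field. Qed.

Lemma gamma_beta (F : numFieldType) m n :
  gamma F m n * beta F m n.+1 + eps F m n * alpha F m n =
  alpha F m.+2 n * eps F m n + beta F m.+2 n * gamma F m n.-1.
Proof.
case: n => [|n] /=; last by parity_field.
(* n = 0 is apart because m + 2 n may vanish in alpha *)
rewrite beta0 mul0r addr0 !alpha0.
rewrite /gamma /beta /eps /by_parity /= /gamma_even /beta_odd /eps_even.
by field; nonzero.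
Qed.

Lemma eps_beta (F : numFieldType) m n :
  eps F m n * beta F m n = beta F m.+2 n * eps F m n.-1.
Proof. by case: n => [|n] /=; [rewrite !beta0 mul0r mulr0 | parity_field]. Qed.

(** * Three-term recurrences and Christoffel transformations *)

(** p_(n+1) = (c X - a_n) p_n - b_n p_(n-1), with p_0 = 1.  The leading
    coefficient c is kept because a_n and b_n are rational for the Meixner
    family below only when that family is not made monic. *)
Fixpoint three_term (R : nzRingType) (c : R) (a b : nat -> R) (n : nat) : {poly R} :=
  if n is n1.+1 then
    (c *: 'X - (a n1)%:P) * three_term c a b n1
    - (if n1 is n2.+1 then (b n1)%:P * three_term c a b n2 else 0)
  else 1.

Lemma three_termS (R : nzRingType) (c : R) (a b : nat -> R) n : b 0%N = 0 ->
  three_term c a b n.+1 =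
  (c *: 'X - (a n)%:P) * three_term c a b n - (b n)%:P * three_term c a b n.-1.
Proof. by case: n => [|n] //= b0; rewrite b0 mul0r. Qed.

Lemma size_lead_three_term (R : nzRingType) (c : R) (a b : nat -> R) n :
  (size (three_term c a b n) <= n.+1)%N /\ (three_term c a b n)`_n = c ^+ n.
Proof.
pose p := three_term c a b; rewrite -/p.
have step k (q : {poly R}) : (size q <= k)%N ->
    (size (p k) <= k.+1)%N /\ (p k)`_k = c ^+ k ->
    (size (((c *: 'X - (a k)%:P) * p k - q)%R) <= k.+2)%N /\
    (((c *: 'X - (a k)%:P) * p k - q)%R)`_k.+1 = c ^+ k.+1.
  move=> sq [sp cp]; split; last first.
    rewrite coefB mulrBl -scalerAl coefB coefZ coefXM coefCM /= cp exprS.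
    rewrite (nth_default 0 (leq_trans sq _)) // (nth_default 0 sp).
    by rewrite mulr0 !subr0.
  rewrite (leq_trans (size_polyD _ _)) // size_polyN geq_max.
  rewrite (leq_trans sq) ?andbT; last by lia.
  rewrite (leq_trans (size_polyMleq _ _)) //.
  have: (size (c *: 'X - (a k)%:P)%R <= 2)%N.
    rewrite (leq_trans (size_polyD _ _)) // geq_max size_polyN.
    rewrite (leq_trans (size_scale_leq _ _)) ?size_polyX //=.
    by rewrite (leq_trans (size_polyC_leq1 _)).
  by move: sp; lia.
suff: ((size (p n) <= n.+1)%N /\ (p n)`_n = c ^+ n) /\
      ((size (p n.+1) <= n.+2)%N /\ (p n.+1)`_n.+1 = c ^+ n.+1) by case.
elim: n => [|n [[IHs IHc] IH]].
  have h0 : (size (p 0%N) <= 1)%N /\ (p 0%N)`_0 = c ^+ 0.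
    by rewrite /p /= size_poly1 coef1.
  by split=> //; apply: (step 0%N 0) => //; rewrite size_poly0.
split=> //; apply: (step n.+1 ((b n.+1)%:P * p n)) => //.
by rewrite mul_polyC (leq_trans (size_scale_leq _ _)).
Qed.

(** Q P'_n and its expansion in the P_k satisfy the same recurrence as soon as
    the coefficients of P_(n+2), P_(n+1), P_n and P_(n-1) agree after
    c X P_k has been replaced by P_(k+1) + a_k P_k + b_k P_(k-1); one
    hypothesis for each of these coefficients. *)
Lemma christoffel_three_term (R : comNzRingType) (c : R) (a b a' b' g e : nat -> R)
    (Q : {poly R}) (P := three_term c a b) (P' := three_term c a' b') n :
    b 0%N = 0 -> b' 0%N = 0 ->
    (forall k, g k.+1 = a k.+2 + g k - a' k) ->
    (forall k, e k.+1 = b k.+2 + g k * a k.+1 + e k - a' k * g k - b' k) ->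
    (forall k, g k * b k.+1 + e k * a k = a' k * e k + b' k * g k.-1) ->
    (forall k, e k * b k = b' k * e k.-1) ->
    Q = P 2%N + (g 0%N)%:P * P 1%N + (e 0%N)%:P ->
  Q * P' n = P n.+2 + (g n)%:P * P n.+1 + (e n)%:P * P n.
Proof.
move=> b0 b'0 Hg He H1 H0 HQ.
have base : Q * P' 0%N = P 2%N + (g 0%N)%:P * P 1%N + (e 0%N)%:P * P 0%N.
  by rewrite HQ /= !mulr1.
have recP k : P k.+1 = (c *: 'X - (a k)%:P) * P k - (b k)%:P * P k.-1.
  exact: three_termS.
have recP' k : P' k.+1 = (c *: 'X - (a' k)%:P) * P' k - (b' k)%:P * P' k.-1.
  exact: three_termS.
have step k : Q * P' k = P k.+2 + (g k)%:P * P k.+1 + (e k)%:P * P k ->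
    (b' k)%:P * (Q * P' k.-1) =
    (b' k)%:P * (P k.-1.+2 + (g k.-1)%:P * P k.-1.+1 + (e k.-1)%:P * P k.-1) ->
    Q * P' k.+1 = P k.+3 + (g k.+1)%:P * P k.+2 + (e k.+1)%:P * P k.+1.
  move=> IH IH'.
  (* at k = 0 the predecessor k.-1 is not k - 1, but b' 0 = 0 *)
  have bP : (b' k)%:P * P k.-1.+1 = (b' k)%:P * P k.
    by case: (k) => [|?] //; rewrite b'0 !mul0r.
  have bP2 : (b' k)%:P * P k.-1.+2 = (b' k)%:P * P k.+1.
    by case: (k) => [|?] //; rewrite b'0 !mul0r.
  have -> : Q * P' k.+1 =
      c *: 'X * P k.+2 + (g k)%:P * (c *: 'X * P k.+1) + (e k)%:P * (c *: 'X * P k)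
      - (a' k)%:P * (P k.+2 + (g k)%:P * P k.+1 + (e k)%:P * P k)
      - ((b' k)%:P * P k.+1 + (g k.-1)%:P * ((b' k)%:P * P k)
         + (e k.-1)%:P * ((b' k)%:P * P k.-1)).
    rewrite recP'.
    have -> : Q * ((c *: 'X - (a' k)%:P) * P' k - (b' k)%:P * P' k.-1) =
      (c *: 'X - (a' k)%:P) * (Q * P' k) - (b' k)%:P * (Q * P' k.-1) by ring.
    rewrite IH IH' -bP -bP2; ring.
  have XP j : c *: 'X * P j = P j.+1 + (a j)%:P * P j + (b j)%:P * P j.-1.
    by rewrite (recP j); ring.
  rewrite !XP /= Hg He; apply/eqP; rewrite -subr_eq0; apply/eqP.
  transitivity
    ((g k * b k.+1 + e k * a k - (a' k * e k + b' k * g k.-1))%:P * P k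
     + (e k * b k - b' k * e k.-1)%:P * P k.-1); first by ring.
  by rewrite H1 H0 !subrr !mul0r addr0.
suff: Q * P' n = P n.+2 + (g n)%:P * P n.+1 + (e n)%:P * P n /\
  Q * P' n.+1 = P n.+3 + (g n.+1)%:P * P n.+2 + (e n.+1)%:P * P n.+1 by case.
elim: n => [|n [IH IH1]].
  by split=> //; apply: step; rewrite // b'0 !mul0r.
by split=> //; apply: step; rewrite //= IH.
Qed.

(** The matrices of coefficients of r and s are triangular. *)
Lemma det_gram (R : comNzRingType) (l : {scalar {poly R}}) (r s : nat -> {poly R})
    (a : nat) :
    (forall i, (size (r i : {poly R}) <= i.+1)%N) -> (forall i, (size (s i) <= i.+1)%N) ->
  \det (\matrix_(i < a, j < a) l (r i * s j)) =
  (\prod_(i < a) (r i)`_i) * (\prod_(i < a) (s i)`_i)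
    * \det (\matrix_(i < a, j < a) l 'X^(i + j)).
Proof.
move=> hr hs.
pose T (p : nat -> {poly R}) := \matrix_(i < a, j < a) (p i)`_j.
have detT (p : nat -> {poly R}) : (forall i, (size (p i) <= i.+1)%N) ->
    \det (T p) = \prod_(i < a) (p i)`_i.
  move=> hp; rewrite det_trig; last first.
    apply/is_trig_mxP => i j ij; rewrite mxE nth_default //.
    exact: leq_trans (hp i) _.
  by apply: eq_bigr => i _; rewrite mxE.
have expand (p : nat -> {poly R}) (i : 'I_a) : (forall i, (size (p i) <= i.+1)%N) ->
    p i = \sum_(k < a) (p i)`_k *: 'X^k.
  move=> hp; rewrite -poly_def; apply/polyP=> k; rewrite coef_poly.
  case: ltnP => // ka; rewrite nth_default //.
  by apply: leq_trans (hp i) (leq_trans _ ka).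
rewrite -(detT r hr) -(detT s hs) -(det_tr (T s)) mulrAC -!det_mulmx; congr (\det _).
apply/matrixP => i j; rewrite !mxE {1}(expand r i hr) {1}(expand s j hs).
rewrite mulr_suml linear_sum -[RHS]/(\sum_j0 _).
under eq_bigr => k _.
  rewrite mulr_sumr linear_sum.
  under eq_bigr => k' _ do
    rewrite -scalerAl -scalerAr -exprD !linearZ /= -/(_ *: _).
  over.
rewrite exchange_big /=; apply: eq_bigr => k _.
rewrite !mxE big_distrl /=; apply: eq_bigr => k' _.
by rewrite /T !mxE; transitivity ((r i)`_k' * ((s j)`_k * l 'X^(k' + k))); last ring.
Qed.

(** * The moment functional *)

(** The third line is ell_m (X^(n+2)) as forced by ell_shift; the first two
    are the normalization and the mean. *)
Fixpoint moment (F : numFieldType) (n m : nat) : F :=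
  match n with
  | 0 => 1
  | 1 => m.+1%:R / 6
  | n1.+2 => - (m.+1%:R * m.+2%:R) / 3 * moment F n1 m.+2
             + (m.+1%:R / 2) ^+ 2 * moment F n1 m
  end.

Definition ell (F : numFieldType) (m : nat) (p : {poly F}) : F :=
  \sum_(i < size p) p`_i * moment F i m.

Lemma ellE (F : numFieldType) m (p : {poly F}) N : (size p <= N)%N ->
  ell m p = \sum_(i < N) p`_i * moment F i m.
Proof.
move=> h; rewrite /ell (big_ord_widen N (fun i => p`_i * moment F i m)) //.
rewrite big_mkcond; apply: eq_bigr => i _; case: ltnP => // hi.
by rewrite nth_default ?mul0r.
Qed.

Lemma ell_is_linear (F : numFieldType) m : scalar (@ell F m).
Proof.
move=> c p q; set N := maxn (size p) (size q).
have hp : (size p <= N)%N by rewrite leq_maxl.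
have hq : (size q <= N)%N by rewrite leq_maxr.
have hpq : (size (c *: p + q)%R <= N)%N.
  by rewrite (leq_trans (size_polyD _ _)) // geq_max hq (leq_trans (size_scale_leq _ _)).
rewrite (ellE m hp) (ellE m hq) (ellE m hpq).
rewrite big_distrr -big_split /=; apply: eq_bigr => i _.
by rewrite coefD coefZ; ring.
Qed.
HB.instance Definition _ (F : numFieldType) m :=
  GRing.isLinear.Build F {poly F} F *%R (@ell F m) (@ell_is_linear F m).

Lemma ellXn (F : numFieldType) m n : ell m ('X^n : {poly F}) = moment F n m.
Proof.
rewrite (@ellE F m _ n.+1) ?size_polyXn // big_ord_recr /= coefXn eqxx mul1r.
by rewrite big1 ?add0r // => i _; rewrite coefXn ltn_eqF ?mul0r.
Qed.
Lemma ell1 (F : numFieldType) m : ell m (1 : {poly F}) = 1.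
Proof. by rewrite -(expr0 'X) ellXn. Qed.

(** The shift m -> m + 2 on which every computation with ell rests. *)
Lemma ell_shift (F : numFieldType) m (p : {poly F}) :
  ell m (('X^2 - ((m.+1%:R / 2) ^+ 2)%:P) * p) =
  - (m.+1%:R * m.+2%:R) / 3 * ell m.+2 p.
Proof.
rewrite -[p]coefK poly_def mulr_sumr !linear_sum big_distrr /=.
apply: eq_bigr => i _; rewrite -scalerAr !linearZ /= ellXn.
rewrite mulrBl -exprD mul_polyC linearB linearZ /= !ellXn add2n /=.
by ring.
Qed.

(** * Orthogonality and the Hankel determinant *)

Definition orth (F : numFieldType) (m : nat) : nat -> {poly F} :=
  three_term 1 (alpha F m) (beta F m).
Arguments orth : simpl never.

Lemma orth_christoffel (F : numFieldType) m n :
  ('X^2 - ((m.+1%:R / 2) ^+ 2)%:P) * orth F m.+2 n =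
  orth F m n.+2 + (gamma F m n)%:P * orth F m n.+1 + (eps F m n)%:P * orth F m n.
Proof.
apply: christoffel_three_term; rewrite ?beta0 //.
- exact: gammaS.
- exact: epsS.
- exact: gamma_beta.
- exact: eps_beta.
rewrite /= gamma0 beta1 !scale1r.
have -> : (m.+1%:R / 2) ^+ 2 = m.+1%:R ^+ 2 / 4 :> F by field.
by ring.
Qed.

Lemma ell_comb (F : numFieldType) m (g e : F) (p q r : {poly F}) :
  ell m (p + g%:P * q + e%:P * r) = ell m p + g * ell m q + e * ell m r.
Proof. by rewrite !linearD /= !mul_polyC !linearZ. Qed.

(** Applying ell_m to orth_christoffel expresses ell_m P_(n+2) through
    ell_m P_(n+1), ell_m P_n and the value for m + 2 at the smaller index n;
    for n = 0 it vanishes because eps_0 is the factor of ell_shift. *)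
Lemma ell_orth0 (F : numFieldType) m n : ell m (orth F m n.+1) = 0.
Proof.
suff: ell m (orth F m n.+1) = 0 /\ ell m (orth F m n.+2) = 0 by case.
elim: n m => [|n IH] m.
  have h1 : ell m (orth F m 1) = 0.
    rewrite /orth /= mulr1 subr0 scale1r linearB /= -['X]expr1 ellXn.
    rewrite -[(alpha F m 0)%:P]mulr1 mul_polyC linearZ /= ell1 mulr1 alpha0.
    by rewrite subrr.
  split=> //.
  have := congr1 (ell m) (orth_christoffel F m 0).
  rewrite ell_shift ell_comb h1 mulr0 addr0 !ell1 !mulr1.
  by rewrite eps0 => /esym/eqP; rewrite -subr_eq0 addrK => /eqP.
have [IH1 IH2] := IH m; split=> //.
have := congr1 (ell m) (orth_christoffel F m n.+1).
rewrite ell_shift (IH m.+2).1 mulr0 ell_comb.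
by rewrite IH1 IH2 !mulr0 !addr0.
Qed.

Lemma orthS (F : numFieldType) m n :
  'X * orth F m n = orth F m n.+1 + (alpha F m n)%:P * orth F m n
                    + (beta F m n)%:P * orth F m n.-1.
Proof. by rewrite /orth (@three_termS _ _ _ _ n) ?beta0 // scale1r; ring. Qed.

(** The three-term recurrence lowers the power of X at the expense of moving the
    index n by at most one. *)
Lemma ell_orthXn (F : numFieldType) m k n :
  ((k < n)%N -> ell m ('X^k * orth F m n) = 0) /\
  ell m ('X^k * orth F m k) = \prod_(l < k) beta F m l.+1.
Proof.
elim: k n => [|k IH] n.
  split; last by rewrite mul1r ell1 big_ord0.
  by case: n => // n _; rewrite mul1r ell_orth0.
have e (p : nat) : ell m ('X^(k.+1) * orth F m p) = ell m ('X^k * orth F m p.+1)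
   + alpha F m p * ell m ('X^k * orth F m p) + beta F m p * ell m ('X^k * orth F m p.-1).
  rewrite exprSr -mulrA orthS !mulrDr !(mulrCA _ _%:P) !mul_polyC !linearD /=.
  by rewrite !linearZ.
split=> [hk|]; rewrite e.
  rewrite (IH n.+1).1 ?(IH n).1 ?(IH n.-1).1 ?mulr0 ?addr0 //; lia.
rewrite (IH k.+2).1 ?(IH k.+1).1 ?mulr0 ?add0r //= (IH 0%N).2.
by rewrite big_ord_recr /= mulrC.
Qed.

Lemma det_moment (F : numFieldType) m a :
  \det (\matrix_(i < a, j < a) ell m ('X^(i + j) : {poly F})) =
  \prod_(i < a) \prod_(l < i) beta F m l.+1.
Proof.
have sX i : (size ('X^i : {poly F}) <= i.+1)%N by rewrite size_polyXn.
have sP i : (size (orth F m i) <= i.+1)%N by case: (size_lead_three_term 1 (alpha F m) (beta F m) i).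
have lP i : (orth F m i)`_i = 1 by case: (size_lead_three_term 1 (alpha F m) (beta F m) i) => _ ->; rewrite expr1n.
have := det_gram (@ell F m) a sX sP.
rewrite big1 => [|i _]; last by rewrite coefXn eqxx.
rewrite big1 => [|i _]; last by rewrite lP.
rewrite !mul1r => <-; rewrite det_trig; last first.
  by apply/is_trig_mxP => i j ij; rewrite mxE /= (ell_orthXn F m i j).1.
by apply: eq_bigr => i _; rewrite mxE /= (ell_orthXn F m i 0).2.
Qed.

(** * The matrix as a Gram matrix *)

(** With theta = 1 - 2 omega and k = X - (m+1)/2, the i-th polynomial is i!
    times the coefficient of x^i in
    (1 - omega x)^k (1 - x/omega)^(-k-m-1). *)
Definition meixner (F : numFieldType) (theta : F) (m : nat) : nat -> {poly F} :=
  three_term theta (fun i => - (i%:R + m.+1%:R / 2)) (fun i => i%:R * (i + m)%:R).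
Arguments meixner : simpl never.

Lemma meixner_christoffel (F : numFieldType) (theta : F) m i : theta ^+ 2 = - 3 ->
  (-3) *: (('X^2 - ((m.+1%:R / 2) ^+ 2)%:P) * meixner theta m.+2 i) =
  meixner theta m i.+2 + (- (m + i + 2)%:R)%:P * meixner theta m i.+1
  + ((m + i + 1)%:R * (m + i + 2)%:R)%:P * meixner theta m i.
Proof.
move=> th2; rewrite scalerAl.
apply: (christoffel_three_term (g := fun i => - (m + i + 2)%:R)
   (e := fun i => (m + i + 1)%:R * (m + i + 2)%:R)).
- by rewrite mul0r.
- by rewrite mul0r.
- by move=> k; field.
- by move=> k; field.
- by case=> [|k] /=; field.
- by case=> [|k] /=; ring.
rewrite /= -!mul_polyC; set h := m.+1%:R / 2.
have hm : m%:R = 2 * h - 1 by rewrite /h; field.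
rewrite !natrD !hm; apply/eqP; rewrite -subr_eq0; apply/eqP.
transitivity (- (theta ^+ 2 + 3)%:P * 'X^2 : {poly F}); first by ring.
by rewrite th2; ring.
Qed.

Definition gram_entry (F : numFieldType) (omega : F) (m i j : nat) : F :=
  (m + i + j)`!%:R + omega * (i == j)%:R * (i`! * (m + i)`!)%:R.

(** The generating function for m + 2 and k - 1 is that for m and k divided by
    (1 - omega x)(1 - x/omega) = 1 - x + x^2; this is why the Meixner family
    also has a Christoffel transformation with rational coefficients, and the
    values follow from it as in ell_orth0. *)
Lemma ell_meixner (F : numFieldType) (omega theta : F) m i :
  omega ^+ 2 = omega - 1 -> theta = 1 - 2 * omega ->
  m`!%:R * (1 + omega) * ell m (meixner theta m i) = gram_entry omega m i 0.
Proof.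
move=> om2 thE.
have th2 : theta ^+ 2 = - 3.
  by rewrite thE; transitivity (1 - 4 * omega + 4 * omega ^+ 2); [ring | rewrite om2; ring].
suff: m`!%:R * (1 + omega) * ell m (meixner theta m i) = gram_entry omega m i 0 /\
  m`!%:R * (1 + omega) * ell m (meixner theta m i.+1) = gram_entry omega m i.+1 0 by case.
elim: i m => [|i IH] m.
  rewrite /gram_entry /= ell1 !addn0 fact0 mul1n !mulr1; split; first by ring.
  rewrite /meixner /= subr0 mulr1 linearB /= linearZ /= -['X]expr1 ellXn /=.
  rewrite -[(- (_ + _))%:P]mulr1 mul_polyC linearZ /= ell1.
  rewrite addn1 factS.
  have -> : m`!%:R * (1 + omega) * (theta * (m.+1%:R / 6) - - (0 + m.+1%:R / 2) * 1)
    = m`!%:R * m.+1%:R * ((1 + omega) * (theta + 3) / 6) by field.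
  have -> : (1 + omega) * (theta + 3) = 6.
    rewrite thE; transitivity (4 + 2 * omega - 2 * omega ^+ 2); first ring.
    by rewrite om2; ring.
  by rewrite mulr0 mul0r addr0 natrM; field.
have [IH0 IH1] := IH m; split=> //.
have := congr1 (ell m) (meixner_christoffel m i th2).
rewrite linearZ /= ell_shift ell_comb.
move=> /(congr1 ( *%R (m`!%:R * (1 + omega)))).
have -> : m`!%:R * (1 + omega) *
   (-3 * (- (m.+1%:R * m.+2%:R) / 3 * ell m.+2 (meixner theta m.+2 i))) =
   m.+2`!%:R * (1 + omega) * ell m.+2 (meixner theta m.+2 i).
  by rewrite !factS; field.
case: (IH m.+2) => -> _.
set K := m`!%:R * (1 + omega) in IH0 IH1 *; rewrite !(mulrDr K) !(mulrCA K) IH0 IH1 => e.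
have -> : K * ell m (meixner theta m i.+2) =
   gram_entry omega m.+2 i 0 + (m + i + 2)%:R * gram_entry omega m i.+1 0
   - (m + i + 1)%:R * (m + i + 2)%:R * gram_entry omega m i 0.
  by rewrite e; ring.
rewrite /gram_entry /= !addn0 !addnS !addSn !factS mulr0 mul0r !addr0.
case: i {IH IH0 IH1 e} => [|i] /=; rewrite ?addn0 ?factS; ring.
Qed.

Lemma meixnerS (F : numFieldType) (theta : F) m n :
  (theta *: 'X) * meixner theta m n = meixner theta m n.+1
    - (n%:R + m.+1%:R / 2)%:P * meixner theta m n
    + (n%:R * (n + m)%:R)%:P * meixner theta m n.-1.
Proof. by rewrite /meixner (@three_termS _ _ _ _ n) ?mul0r //; ring. Qed.

(** The identity says that multiplication by theta X is symmetric for the Gram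
    matrix; it holds separately for the factorial and for the diagonal part. *)
Lemma gram_entryS (F : numFieldType) (omega : F) m i j :
  gram_entry omega m i j.+1 = gram_entry omega m i.+1 j
    + (j%:R - i%:R) * gram_entry omega m i j
    + i%:R * (i + m)%:R * gram_entry omega m i.-1 j
    - j%:R * (j + m)%:R * gram_entry omega m i j.-1.
Proof.
rewrite /gram_entry; pose d (i j : nat) : F := (i == j)%:R * (i`! * (m + i)`!)%:R.
have d_up k l : d k.+1 l = l%:R * (l + m)%:R * d k l.-1.
  case: l => [|l]; first by rewrite /d !mul0r.
  rewrite /d eqSS /=; case: eqP => [->|_]; last by rewrite !mul0r mulr0.
  by rewrite addnS !factS; ring.
have d_down k l : d k l.+1 = k%:R * (k + m)%:R * d k.-1 l.
  case: k => [|k]; first by rewrite /d /= !mul0r.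
  rewrite /d eqSS /=; case: eqP => [->|_]; last by rewrite !mul0r mulr0.
  by rewrite addnS !factS; ring.
have d_diag : (j%:R - i%:R) * d i j = 0.
  by rewrite /d; case: eqP => [->|_]; rewrite ?subrr ?mul0r ?mulr0.
have f_diag : (j%:R - i%:R) * (m + i + j)`!%:R + i%:R * (i + m)%:R * (m + i.-1 + j)`!%:R
    - j%:R * (j + m)%:R * (m + i + j.-1)`!%:R = 0 :> F.
  case: i {d_diag} => [|i]; case: j => [|j] /=;
    rewrite ?addn0 ?addSn ?addnS ?addSn ?factS; ring.
have -> : (m + i.+1 + j = m + i + j.+1)%N by lia.
rewrite -![omega * _ * _]mulrA -!/(d _ _).
rewrite d_up d_down.
set x := (m + i + j)`!%:R in f_diag *.
apply/eqP; rewrite -subr_eq0; apply/eqP.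
transitivity (- ((j%:R - i%:R) * x + i%:R * (i + m)%:R * (m + i.-1 + j)`!%:R
    - j%:R * (j + m)%:R * (m + i + j.-1)`!%:R) - omega * ((j%:R - i%:R) * d i j)).
  by ring.
by rewrite f_diag d_diag mulr0 !oppr0 addr0.
Qed.

Lemma ell_meixner_mul (F : numFieldType) (omega theta : F) m i j :
  omega ^+ 2 = omega - 1 -> theta = 1 - 2 * omega ->
  m`!%:R * (1 + omega) * ell m (meixner theta m i * meixner theta m j) =
  gram_entry omega m i j.
Proof.
move=> om2 thE; pose T i j := m`!%:R * (1 + omega) * ell m (meixner theta m i * meixner theta m j).
rewrite -/(T i j).
have step i' j' : T i' j'.+1 = T i'.+1 j' + (j'%:R - i'%:R) * T i' j'
    + i'%:R * (i' + m)%:R * T i'.-1 j' - j'%:R * (j' + m)%:R * T i' j'.-1.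
  have : meixner theta m i' * meixner theta m j'.+1 =
     meixner theta m i'.+1 * meixner theta m j'
     + (j'%:R - i'%:R) *: (meixner theta m i' * meixner theta m j')
     + (i'%:R * (i' + m)%:R) *: (meixner theta m i'.-1 * meixner theta m j')
     + (- (j'%:R * (j' + m)%:R)) *: (meixner theta m i' * meixner theta m j'.-1).
    have := meixnerS theta m j'.
    set A := meixner theta m j'.+1 => eA.
    have -> : A = theta *: 'X * meixner theta m j' + (j'%:R + m.+1%:R / 2)%:P * meixner theta m j'
       - (j'%:R * (j' + m)%:R)%:P * meixner theta m j'.-1 by rewrite eA; ring.
    have -> : meixner theta m i'.+1 = theta *: 'X * meixner theta m i' + (i'%:R + m.+1%:R / 2)%:P * meixner theta m i'
       - (i'%:R * (i' + m)%:R)%:P * meixner theta m i'.-1 by rewrite meixnerS; ring.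
    by rewrite -!mul_polyC; ring.
  by rewrite /T => ->; rewrite !linearD /= !linearZ /=; ring.
have T0 i' : T i' 0%N = gram_entry omega m i' 0 by rewrite /T mulr1 ell_meixner.
suff: (forall i, T i j = gram_entry omega m i j) /\ (forall i, T i j.-1 = gram_entry omega m i j.-1).
  by case.
elim: j {i} => [|j [IH IH']]; first by split; apply: T0.
by split=> // i; rewrite step !IH IH' -gram_entryS.
Qed.

(** * The determinant as a double product *)

Lemma det_scale (R : comNzRingType) a (u v : nat -> R) (M : nat -> nat -> R) :
  \det (\matrix_(i < a, j < a) (u i * v j * M i j)) =
  (\prod_(i < a) u i) * (\prod_(i < a) v i) * \det (\matrix_(i < a, j < a) M i j).
Proof.
pose U := \row_(i < a) u i; pose V := \row_(i < a) v i.
have -> : \matrix_(i < a, j < a) (u i * v j * M i j) =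
    diag_mx U *m (\matrix_(i < a, j < a) M i j) *m diag_mx V.
  by apply/matrixP => i j; rewrite mul_mx_diag mul_diag_mx !mxE mulrAC.
rewrite !det_mulmx !det_diag mulrAC.
by congr (_ * _ * _); apply: eq_bigr => i _; rewrite mxE.
Qed.

(** The norm ratio beta_l, corrected by the leading coefficients theta^l (whose
    square contributes - 3 at each step) and by the scaling factors (m + l)! and
    l! of the rows and columns. *)
Definition kappa (F : numFieldType) (m l : nat) : F :=
  - 3 * beta F m l / (l%:R * (m + l)%:R).

(** Two evaluations of the Gram determinant of the Meixner family: by its
    entries, and through the Hankel determinant of ell_m. *)
Lemma det_double_product (F : numFieldType) (omega : F) a m : omega ^+ 2 = omega - 1 ->
  \det (\matrix_(i < a, j < a) (omega * (i == j)%:R + 'C(m + i + j, j)%:R)) =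
  (1 + omega) ^+ a * \prod_(i < a) \prod_(l < i) kappa F m l.+1.
Proof.
move=> om2; pose theta := 1 - 2 * omega.
have th2 : theta ^+ 2 = - 3.
  by rewrite /theta; transitivity (1 - 4 * omega + 4 * omega ^+ 2); [ring | rewrite om2; ring].
have fact_neq0 k : k`!%:R != 0 :> F by rewrite pnatr_eq0 -lt0n fact_gt0.
have size_q i : (size (meixner theta m i) <= i.+1)%N.
  by case: (size_lead_three_term theta (fun i => - (i%:R + m.+1%:R / 2)) (fun i => i%:R * (i + m)%:R) i).
have lead_q i : (meixner theta m i)`_i = theta ^+ i.
  by case: (size_lead_three_term theta (fun i => - (i%:R + m.+1%:R / 2)) (fun i => i%:R * (i + m)%:R) i).
pose D := \det (\matrix_(i < a, j < a) (omega * (i == j :> nat)%:R + 'C(m + i + j, j)%:R)).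
have lhs : \det (\matrix_(i < a, j < a) gram_entry omega m i j) =
    (\prod_(i < a) (m + i)`!%:R) * (\prod_(i < a) i`!%:R) * D.
  rewrite -(det_scale a (fun i => (m + i)`!%:R) (fun i => i`!%:R)
      (fun i j => omega * (i == j)%:R + 'C(m + i + j, j)%:R)).
  congr (\det _); apply/matrixP => i j; rewrite !mxE /gram_entry.
  have -> : (m + i + j)`! = ('C(m + i + j, j) * ((m + i)`! * j`!))%N.
    by rewrite -(@bin_fact (m + i + j) j) ?leq_addl // addnK [((m + i)`! * _)%N]mulnC.
  by case: eqP => [->|_] /=; rewrite !natrM; ring.
have rhs : \det (\matrix_(i < a, j < a) gram_entry omega m i j) =
    (m`!%:R * (1 + omega)) ^+ a * (\prod_(i < a) theta ^+ i) ^+ 2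
     * \prod_(i < a) \prod_(l < i) beta F m l.+1.
  rewrite -det_moment.
  have -> : (\prod_(i < a) theta ^+ i) ^+ 2 =
     (\prod_(i < a) (meixner theta m i)`_i) * (\prod_(i < a) (meixner theta m i)`_i).
    by rewrite expr2; congr (_ * _); apply: eq_bigr => i _; rewrite lead_q.
  rewrite -mulrA -(det_gram (@ell F m) a size_q size_q) -detZ; congr (\det _).
  by apply/matrixP => i j; rewrite !mxE /= ell_meixner_mul.
rewrite -/D; apply: (@mulfI _ ((\prod_(i < a) (m + i)`!%:R) * (\prod_(i < a) i`!%:R))).
  by rewrite mulf_neq0 //; apply/prodf_neq0 => i _.
have kappa_prod i : (m + i)`!%:R * i`!%:R * (\prod_(l < i) kappa F m l.+1) =
    m`!%:R * (theta ^+ i * theta ^+ i) * \prod_(l < i) beta F m l.+1.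
  rewrite -exprMn -expr2 th2; elim: i => [|i IH]; first by rewrite !big_ord0 addn0 fact0 !mulr1.
  rewrite !big_ord_recr /= exprS addnS !factS !natrM.
  have nz k : k.+1%:R != 0 :> F by rewrite pnatr_eq0.
  transitivity ((m + i).+1%:R * i.+1%:R * kappa F m i.+1 *
     ((m + i)`!%:R * i`!%:R * (\prod_(l < i) kappa F m l.+1))); first by ring.
  rewrite IH /kappa addnS; field; rewrite -natrD !nat1r !nz //.
rewrite -lhs rhs exprMn -big_split /= expr2 -big_split /=.
have -> : m`!%:R ^+ a = \prod_(i < a) m`!%:R :> F by rewrite prodr_const card_ord.
transitivity ((1 + omega) ^+ a * \prod_(i < a)
   (m`!%:R * (theta ^+ i * theta ^+ i) * \prod_(l < i) beta F m l.+1)).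
  by rewrite !big_split /=; ring.
rewrite mulrCA -big_split /=; congr (_ * _).
by apply: eq_bigr => i _; rewrite -kappa_prod.
Qed.

(** * The right-hand side *)

Lemma poch0 (R : pzRingType) (x : R) : poch x 0 = 1.
Proof. exact: big_ord0. Qed.

Lemma pochS (R : pzRingType) (x : R) k : poch x k.+1 = poch x k * (x + k%:R).
Proof. exact: big_ord_recr. Qed.

Lemma poch_shift (R : comPzRingType) (x : R) k : x * poch (x + 1) k = poch x k.+1.
Proof.
rewrite /poch big_ord_recl addr0; congr (_ * _); apply: eq_bigr => l _.
by rewrite lift0 -addrA nat1r.
Qed.

Arguments floor_half : simpl never.

Lemma odd_dfactS n : odd_dfact n.+1 = (odd_dfact n * (2 * n + 1))%N.
Proof. by rewrite /odd_dfact big_nat_recr //=; congr (_ * _)%N; lia. Qed.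

Lemma odd_dfact0 : odd_dfact 0 = 1%N.
Proof. by rewrite /odd_dfact big_nil. Qed.

Definition rhs_const (F : numFieldType) (a : nat) : F :=
  (2 / 3) ^+ floor_half a 0
    / (\prod_(1 <= i < (floor_half a 0).+1) (odd_dfact i)%:R
       * \prod_(1 <= i < (floor_half a 1).+1) (odd_dfact i)%:R).
Definition rhs_const_ratio (F : numFieldType) (a : nat) : F :=
  (if odd a then 2 / 3 else 1) / (odd_dfact (uphalf a))%:R.

Lemma rhs_constS (F : numFieldType) a : rhs_const F a.+1 = rhs_const F a * rhs_const_ratio F a.
Proof.
rewrite /rhs_const /rhs_const_ratio.
pose p n : F := \prod_(1 <= i < n.+1) (odd_dfact i)%:R.
rewrite -!/(p _).
have pS n : p n.+1 = p n * (odd_dfact n.+1)%:R by rewrite /p big_nat_recr.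
have p0 : p 0%N = 1 by rewrite /p big_nil.
rewrite -(odd_double_half a); set b := a./2; case: (odd a); rewrite ?add1n ?add0n /=.
  have -> : floor_half b.*2.+2 0 = b.+1 by rewrite /floor_half; lia.
  have -> : floor_half b.*2.+2 1 = b by rewrite /floor_half; lia.
  have -> : floor_half b.*2.+1 0 = b by rewrite /floor_half; lia.
  have -> : floor_half b.*2.+1 1 = b by rewrite /floor_half; lia.
  by rewrite odd_double doubleK /= pS exprS !invfM; ring.
rewrite odd_double /=.
have -> : floor_half b.*2.+1 0 = b by rewrite /floor_half; lia.
have -> : floor_half b.*2.+1 1 = b by rewrite /floor_half; lia.
have -> : floor_half b.*2 0 = b by rewrite /floor_half; lia.
have -> : uphalf b.*2 = b by lia.
case: (b) => [|c]; last first.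
  have -> : floor_half c.+1.*2 1 = c by rewrite /floor_half; lia.
  by rewrite pS !invfM; ring.
have -> : floor_half 0.*2 1 = 0%N by rewrite /floor_half; lia.
by rewrite odd_dfact0 !p0 !mulr1 !divr1 mulr1.
Qed.

Definition rhs_factor (F : numFieldType) (i a m : nat) : F :=
  poch (m%:R / 2 + 3 * i%:R + 3 / 2) (floor_half a (4 * i + 1)%N)
  * poch (m%:R / 2 + 3 * i%:R + 5 / 2) (floor_half a (4 * i + 2)%N)
  * poch (m%:R / 2 + a%:R - i%:R) (floor_half a (4 * i)%N)
  * poch (m%:R / 2 + a%:R - i%:R) (floor_half a (4 * i + 3)%N).

Lemma rhs_factor1 (F : numFieldType) i a m : (a <= 4 * i)%N -> rhs_factor F i a m = 1.
Proof.
move=> ai; rewrite /rhs_factor /floor_half.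
have e k : ((a - (4 * i + k)) = 0)%N by lia.
by rewrite !e -[(4 * i)%N]addn0 e /= !poch0 !mulr1.
Qed.

(** Removing the factor i = 0 amounts to replacing (a, m) by (a - 4, m + 6). *)
Lemma rhs_factor_shift (F : numFieldType) i a m :
  rhs_factor F i.+1 (a + 4) m = rhs_factor F i a (m + 6).
Proof.
rewrite /rhs_factor; congr (poch _ _ * poch _ _ * poch _ _ * poch _ _);
  by [field | rewrite /floor_half; lia].
Qed.

Definition rhs_prod (F : numFieldType) (a m : nat) : F := \prod_(i < a) rhs_factor F i a m.

Lemma rhs_prod_widen (F : numFieldType) a m N : (a <= N)%N ->
  \prod_(i < N) rhs_factor F i a m = rhs_prod F a m.
Proof.
move=> aN; rewrite /rhs_prod (big_ord_widen N (fun i => rhs_factor F i a m) aN).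
rewrite [RHS]big_mkcond; apply: eq_bigr => i _; case: ltnP => // ai.
by rewrite rhs_factor1 //; lia.
Qed.

Lemma rhs_prod_shift (F : numFieldType) a m :
  rhs_prod F (a + 4) m = rhs_factor F 0 (a + 4) m * rhs_prod F a (m + 6).
Proof.
rewrite -(@rhs_prod_widen F (a + 4) m (a + 4).+1) // big_ord_recl; congr (_ * _).
rewrite -(@rhs_prod_widen F a (m + 6) (a + 4)) ?leq_addr //.
by apply: eq_bigr => i _; rewrite lift0 rhs_factor_shift.
Qed.

(** The ratio of the determinants of sizes a + 1 and a is 1 + omega times
    rho m a. *)
Definition rho (F : numFieldType) (m a : nat) : F := \prod_(l < a) kappa F m l.+1.

(** The factor by which rho changes between (a, m + 6) and (a + 4, m).  It is
    found as the ratio of the factors i = 0 of the right-hand side at a + 5 and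
    a + 4, times a ratio of constants, see rhs_factor0_step. *)
Definition sigma (F : numFieldType) (m a : nat) : F :=
  let y := m%:R in let x := a%:R in
  if odd a then
    (y + x + 6) * (y + 3 * x + 9) * (y + 3 * x + 11) * (y + 3 * x + 13)
    / (4 * (y + 2 * x + 8) ^+ 2 * (x + 2) * (x + 4))
  else
    (y + x + 5) * (y + 3 * x + 8) * (y + 3 * x + 10) * (y + 3 * x + 12)
    / (4 * (y + 2 * x + 8) ^+ 2 * (x + 1) * (x + 3)).

Lemma rho_shift (F : numFieldType) m a :
  rho F m (a + 4) = sigma F m a * rho F (m + 6) a.
Proof.
elim: a => [|a IH].
  rewrite add0n /rho !big_ord_recr !big_ord0 /= /sigma /= mul1r.
  rewrite /kappa /beta /by_parity /= /beta_even /beta_odd.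
  field; nonzero.
rewrite addSn {1}/rho big_ord_recr /= -/(rho F m (a + 4)) IH.
rewrite /rho big_ord_recr /= -/(rho F (m + 6) a).
have sigma_neq0 : sigma F m a != 0.
  by rewrite /sigma /=; case: (odd a); rewrite !mulf_eq0 !invr_eq0 !mulf_eq0 !negb_or; nonzero.
suff -> : kappa F m (a + 4).+1 = sigma F m a.+1 * kappa F (m + 6) a.+1 / sigma F m a.
  by field.
by rewrite /kappa /beta /by_parity /sigma addnC /=; case: (odd a) => /=;
  rewrite /beta_even /beta_odd; field; nonzero.
Qed.

Lemma rhs_factor0_step (F : numFieldType) a m :
  rhs_const_ratio F (a + 4) * rhs_factor F 0 (a + 5) m =
  sigma F m a * rhs_const_ratio F a * rhs_factor F 0 (a + 4) m.
Proof.
rewrite /rhs_const_ratio /rhs_factor oddD addbF !muln0 !add0n mulr0 !addr0 !subr0.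
have -> : uphalf (a + 4) = (uphalf a).+2 by lia.
rewrite !odd_dfactS !natrM.
have od_neq0 : (odd_dfact (uphalf a))%:R != 0 :> F.
  rewrite pnatr_eq0 -lt0n /odd_dfact big_nat prodn_cond_gt0 // => i; lia.
set od := (odd_dfact _)%:R in od_neq0 *.
rewrite /sigma.
set t : F := m%:R / 2.
have mt : m%:R = 2 * t by rewrite /t; field.
set b := a./2.
have ab := odd_double_half a; rewrite -/b in ab.
have t_gt0 k : t + k.+1%:R != 0.
  by apply: lt0r_neq0; rewrite ltr_wpDl ?ltr0Sn // divr_ge0 ?ler0n.
set x := t + (a + 4)%:R.
have x0 : x != 0 by rewrite /x addn4.
have -> : t + (a + 5)%:R = x + 1 by rewrite /x; ring.
have px k : poch (x + 1) k = poch x k.+1 / x by rewrite -poch_shift mulrC mulKf.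
case: (boolP (odd a)) => oa; rewrite ?oa ?(negbTE oa) /= in ab *.
  have -> : uphalf a = b.+1 by lia.
  have -> : floor_half (a + 5) 1 = b.+2 by rewrite /floor_half; lia.
  have -> : floor_half (a + 5) 2 = b.+2 by rewrite /floor_half; lia.
  have -> : floor_half (a + 5) 0 = b.+3 by rewrite /floor_half; lia.
  have -> : floor_half (a + 5) 3 = b.+1 by rewrite /floor_half; lia.
  have -> : floor_half (a + 4) 1 = b.+2 by rewrite /floor_half; lia.
  have -> : floor_half (a + 4) 2 = b.+1 by rewrite /floor_half; lia.
  have -> : floor_half (a + 4) 0 = b.+2 by rewrite /floor_half; lia.
  have -> : floor_half (a + 4) 3 = b.+1 by rewrite /floor_half; lia.
  have -> : a%:R = 2 * b%:R + 1 :> F by rewrite -ab -muln2; ring.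
  have xE : x = t + 2 * b%:R + 5 by rewrite /x -ab -muln2; ring.
  rewrite !px !pochS {px} mt xE in x0 *; field.
  rewrite od_neq0 x0 andbT /=.
  have -> : 2 * t + 2 * (2 * b%:R + 1) + 8 = 2 * (t + 2 * b%:R + 5) by ring.
  by rewrite (mulf_neq0 _ x0) ?andbT; nonzero.
have -> : uphalf a = b by lia.
have -> : floor_half (a + 5) 1 = b.+2 by rewrite /floor_half; lia.
have -> : floor_half (a + 5) 2 = b.+1 by rewrite /floor_half; lia.
have -> : floor_half (a + 5) 0 = b.+2 by rewrite /floor_half; lia.
have -> : floor_half (a + 5) 3 = b.+1 by rewrite /floor_half; lia.
have -> : floor_half (a + 4) 1 = b.+1 by rewrite /floor_half; lia.
have -> : floor_half (a + 4) 2 = b.+1 by rewrite /floor_half; lia.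
have -> : floor_half (a + 4) 0 = b.+2 by rewrite /floor_half; lia.
have -> : floor_half (a + 4) 3 = b by rewrite /floor_half; lia.
have -> : a%:R = 2 * b%:R :> F by rewrite -ab -muln2; ring.
have xE : x = t + 2 * b%:R + 4 by rewrite /x -ab -muln2; ring.
rewrite !px !pochS {px} mt xE in x0 *; field.
rewrite od_neq0 x0 andbT /=.
have -> : 2 * t + 2 * (2 * b%:R) + 8 = 2 * (t + 2 * b%:R + 4) by ring.
by rewrite (mulf_neq0 _ x0) ?andbT; nonzero.
Qed.

Lemma rhs_prod_small (F : numFieldType) a m : (a <= 4)%N -> rhs_prod F a m = rhs_factor F 0 a m.
Proof.
case: a => [|a] a4; first by rewrite rhs_factor1 // /rhs_prod big_ord0.
rewrite /rhs_prod big_ord_recl big1 ?mulr1 // => i _.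
by rewrite rhs_factor1 // lift0; lia.
Qed.

(** Both sides satisfy the same relation between (a, m) and (a - 4, m + 6), by
    rho_shift and rhs_factor0_step; the cases a < 4 are direct. *)
Lemma rhs_prod_step (F : numFieldType) a m :
  rhs_const_ratio F a * rhs_prod F a.+1 m = rhs_prod F a m * rho F m a.
Proof.
have [k] := ubnP a; elim: k a m => // k IH a m ak.
have [a4 | a4] := ltnP a 4.
  rewrite !rhs_prod_small //; last by lia.
  rewrite /rho; case: a a4 {ak} => [|[|[|[|//]]]] _;
    rewrite ?big_ord_recr big_ord0 /rhs_const_ratio /rhs_factor /floor_half !muln0 /=
      ?(subSS, subn0, sub0n) /= ?pochS !poch0 /kappa /beta /by_parity
      ?odd_dfactS odd_dfact0 /= /beta_odd /beta_even.
  - by field.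
  - by field; nonzero.
  - by field; nonzero.
  - by field; nonzero.
have [b ab] : exists b, a = (b + 4)%N by exists (a - 4)%N; rewrite subnK.
rewrite ab in ak *; have bk : (b < k)%N by lia.
rewrite -addSn !rhs_prod_shift rho_shift.
transitivity (rhs_const_ratio F (b + 4) * rhs_factor F 0 (b + 5) m * rhs_prod F b.+1 (m + 6)).
  by rewrite [(b + 5)%N]addnS; ring.
rewrite rhs_factor0_step.
transitivity (sigma F m b * rhs_factor F 0 (b + 4) m
  * (rhs_const_ratio F b * rhs_prod F b.+1 (m + 6))); first by ring.
by rewrite (IH b (m + 6)%N bk); ring.
Qed.

Lemma rhs_prod_closed (F : numFieldType) a m :
  rhs_const F a * rhs_prod F a m = \prod_(i < a) rho F m i.
Proof.
elim: a => [|a IH].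
  by rewrite /rhs_prod !big_ord0 /rhs_const /floor_half /= !big_nil expr0 !mulr1 divr1.
rewrite big_ord_recr /= -IH rhs_constS.
by rewrite -[LHS]mulrA rhs_prod_step mulrA.
Qed.

Lemma sixth_root_quadratic (F : numFieldType) (omega : F) :
  6.-primitive_root omega -> omega ^+ 2 = omega - 1.
Proof.
move=> prim; have om_neq k : ~~ (6 %| k)%N -> omega ^+ k != 1.
  by rewrite -(prim_order_dvd prim).
have om6 := prim_expr_order prim.
have om3 : omega ^+ 3 = - 1.
  have : (omega ^+ 3 - 1) * (omega ^+ 3 + 1) = 0 by rewrite -subr_sqr expr1n -exprM om6 subrr.
  move/eqP; rewrite mulf_eq0 subr_eq0 (negbTE (om_neq 3%N isT)) /= addr_eq0.
  by move/eqP.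
have : (omega + 1) * (omega ^+ 2 - (omega - 1)) = 0.
  by transitivity (omega ^+ 3 + 1); [ring | rewrite om3 addNr].
move/eqP; rewrite mulf_eq0 addr_eq0 subr_eq0 => /orP[/eqP omN1 | /eqP //].
by have := om_neq 2%N isT; rewrite omN1 sqrrN expr1n eqxx.
Qed.

Theorem theorem13 (C : numClosedFieldType) (omega : C)
    (homega : 6.-primitive_root omega) (a m : nat) :
  \det (\matrix_(i < a, j < a)
          (omega * (i == j)%:R + 'C(m + i + j, j)%:R)) =
  (1 + omega) ^+ a * (2 / 3) ^+ floor_half a 0
    / (\prod_(1 <= i < (floor_half a 0).+1) (odd_dfact i)%:R
       * \prod_(1 <= i < (floor_half a 1).+1) (odd_dfact i)%:R)
  * \big[*%R/1]_(i \in [set: nat]%classic)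
      (poch (m%:R / 2 + 3 * i%:R + 3 / 2 : C) (floor_half a (4 * i + 1)%N)
       * poch (m%:R / 2 + 3 * i%:R + 5 / 2 : C) (floor_half a (4 * i + 2)%N)
       * poch (m%:R / 2 + a%:R - i%:R : C) (floor_half a (4 * i)%N)
       * poch (m%:R / 2 + a%:R - i%:R : C) (floor_half a (4 * i + 3)%N)).
Proof.
rewrite (det_double_product a m (sixth_root_quadratic homega)).
have -> : \big[*%R/1]_(i \in [set: nat]%classic) rhs_factor C i a m = rhs_prod C a m.
  rewrite (fsbigE (iota 0 a)) ?iota_uniq //=; last first.
    by move=> i _; rewrite mem_iota add0n -leqNgt => ai; rewrite rhs_factor1 //; lia.
  under eq_bigl => i do rewrite in_setT.
  by rewrite /rhs_prod -(big_mkord xpredT (fun i => rhs_factor C i a m)) /index_iota subn0.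
by rewrite -!mulrA; congr (_ * _); rewrite -rhs_prod_closed /rhs_const -!mulrA.
Qed.
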